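(* Let $L\ge 2$ be an even integer and let $h_1,\dots,h_L\in\mathbb{R}$. For $J\in\mathbb{R}$ let $\hat H=\hat H_0+\hat V$ act on the zero-magnetization sector, where $$\hat H_0=-\sum_{j=1}^{L}h_j\hat S^z_j,\qquad \hat V=J\sum_{j=1}^{L}\hat{\mathbf S}_j\cdot\hat{\mathbf S}_{j+1},$$ and let $\{|\alpha\rangle\}$ be the $\hat S^z$ product basis of this sector, with $\hat H_0|\alpha\rangle=E^{(0)}_\alpha|\alpha\rangle$. Fix a basis vector $|\alpha\rangle$ such that $E^{(0)}_\beta\ne E^{(0)}_\alpha$ for all $\beta\neq\alpha$. For $J$ near $0$ let $|\psi\rangle=|\psi(J)\rangle$ be the eigenvector of $\hat H$ whose coefficient on $|\alpha\rangle$ equals $1$ and which satisfies, as $J\to 0$, $$|\psi\rangle=|\alpha\rangle+\sum_{\beta\ne\alpha}c^{(1)}_\beta|\beta\rangle+\mathcal{O}(J^2),\qquad c^{(1)}_\beta=\frac{\langle\beta|\hat V|\alpha\rangle}{E^{(0)}_\alpha-E^{(0)}_\beta}.$$ Put $\langle\psi|\psi\rangle^{(2)}=\sum_{\beta\neq\alpha}|c^{(1)}_\beta|^2$. Then, as $J\to0$, $$\left|\frac{\langle\psi|\hat U_{\mathrm{twist}}|\psi\rangle}{1+\langle\psi|\psi\rangle^{(2)}}-\langle\alpha|\hat U_{\mathrm{twist}}|\alpha\rangle\right|\le 2\sin\left(\frac{\pi}{L}\right)\frac{\langle\psi|\psi\rangle^{(2)}}{1+\langle\psi|\psi\rangle^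{(2)}}+\mathcal{O}(J^3).$$
   Context: The chain has sites $j=1,\dots,L$ and Hilbert space $(\mathbb{C}^2)^{\otimes L}$. $\hat{\mathbf S}_j=(\hat S^x_j,\hat S^y_j,\hat S^z_j)$ are the spin-$1/2$ operators (half the Pauli matrices) acting on the $j$-th tensor factor, $\hat{\mathbf S}_j\cdot\hat{\mathbf S}_{k}=\hat S^x_j\hat S^x_k+\hat S^y_j\hat S^y_k+\hat S^z_j\hat S^z_k$, and periodic boundary conditions $\hat{\mathbf S}_{L+1}=\hat{\mathbf S}_1$ are imposed. The $\hat S^z$ product basis consists of the tensor products of single-site up/down vectors (simultaneous eigenvectors of all $\hat S^z_j$, with eigenvalues $\pm1/2$). The zero-magnetization sector is the span of those product basis vectors for which $\sum_j\hat S^z_j$ has eigenvalue $0$; both $\hat H_0$ and $\hat V$ preserve it. The twist operator is the unitary $$\hat U_{\mathrm{twist}}=\exp\left[i\frac{2\pi}{L}\sum_{j=1}^{L}j\,\hat S^z_j\right].$$ The notation $\mathcal{O}(J^k)$ refers to the limit $J\to0$ with $L$, the fields $h_1,\dots,h_L$ and $|\alpha\rangle$ fixed. *)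

(* Defs.v *)
From mathcomp Require Import all_boot all_order all_algebra.
From mathcomp Require Import complex.
From mathcomp Require Import all_classical all_reals all_analysis.
Import numFieldNormedType.Exports.

Set Implicit Arguments.
Unset Strict Implicit.
Unset Printing Implicit Defensive.

Import Order.TTheory GRing.Theory Num.Theory.

Local Open Scope classical_set_scope.
Local Open Scope complex_scope.
Local Open Scope ring_scope.

(* A configuration assigns to each site the index of a single-site basis
   vector, 0 for up and 1 for down.  Site j = 1, ..., L of the chain is the
   ordinal of value j - 1. *)
Definition config (L : nat) := {ffun 'I_L -> 'I_2}.

Section Hilbert.
Context {R : realType} {L : nat}.

(* (C^2)^{(x) L}, in coordinates with respect to the product basis. *)
Local Notation vect := 'cV[R[i]]_(#|config L|).
Local Notation oper := 'M[R[i]]_(#|config L|).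

Definition ket (s : config L) : vect := delta_mx (enum_rank s) 0.

Definition inner (phi psi : vect) : R[i] := ((map_mx conjc phi)^T *m psi) 0 0.

Definition braket (phi : vect) (A : oper) (psi : vect) : R[i] :=
  inner phi (A *m psi).

Definition hnorm (psi : vect) : R := Num.sqrt (complex.Re (inner psi psi)).

(* The Kronecker product A_1 (x) ... (x) A_L. *)
Definition tensor_op (A : 'I_L -> 'M[R[i]]_2) : oper :=
  \matrix_(s, t)
    \prod_j A j ((enum_val s : config L) j) ((enum_val t : config L) j).

Definition site_op (j : 'I_L) (a : 'M[R[i]]_2) : oper :=
  tensor_op (fun k => if k == j then a else 1%:M).

Definition sigma_x : 'M[R[i]]_2 := \matrix_(a, b) (a != b)%:R.
Definition sigma_y : 'M[R[i]]_2 :=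
  \matrix_(a, b) (if (a < b)%N then - 'i%C else if (b < a)%N then 'i%C else 0).
Definition sigma_z : 'M[R[i]]_2 := \matrix_(a, b) ((-1) ^+ a *+ (a == b)).

Definition Sx (j : 'I_L) : oper := site_op j (2^-1 *: sigma_x).
Definition Sy (j : 'I_L) : oper := site_op j (2^-1 *: sigma_y).
Definition Sz (j : 'I_L) : oper := site_op j (2^-1 *: sigma_z).

Definition spin_dot (j k : 'I_L) : oper :=
  Sx j *m Sx k + Sy j *m Sy k + Sz j *m Sz k.

Definition hamiltonian0 (h : 'I_L -> R) : oper := - \sum_j (h j)%:C *: Sz j.

(* ordS is the cyclic successor, so the last site is coupled to the first. *)
Definition interaction (J : R) : oper := J%:C *: \sum_j spin_dot j (ordS j).

Definition hamiltonian (h : 'I_L -> R) (J : R) : oper :=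
  hamiltonian0 h + interaction J.

Definition zero_mag (s : config L) : bool := (\sum_j Sz j) *m ket s == 0.

Definition zero_sector : {vspace vect} :=
  (\sum_(s : config L | zero_mag s) <[ket s]>)%VS.

(* The exponential series, summed entrywise; real and imaginary parts are
   taken separately because limits are taken in R. *)
Definition expmx (A : oper) : oper :=
  let term k := (k`!%:R : R[i])^-1 *: A ^+ k in
  \matrix_(s, t)
    ((limn (series (fun k => complex.Re (term k s t)))) +i*
     (limn (series (fun k => complex.Im (term k s t)))))%C.

Definition twist : oper :=
  expmx (('i%C * (2 * pi / L%:R)%:C) *: \sum_(j < L) j.+1%:R *: Sz j).

(* First-order coefficient on ket t of the perturbed ket s, for the
   unperturbed energies E0. *)
Definition first_order_coef (E0 : config L -> R) (s : config L) (J : R)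
    (t : config L) : R[i] :=
  braket (ket t) (interaction J) (ket s) / (E0 s - E0 t)%:C.

Definition norm_order2 (E0 : config L -> R) (s : config L) (J : R) : R :=
  \sum_(t | zero_mag t && (t != s))
    Normc.normc (first_order_coef E0 s J t) ^+ 2.

End Hilbert.

Arguments twist R L : clear implicits.
Arguments zero_sector R L : clear implicits.
Arguments zero_mag R {L} s.

(* Main.v *)
Require Import Defs.
From mathcomp Require Import all_boot all_order all_algebra.
From mathcomp Require Import complex.
From mathcomp Require Import all_classical all_reals all_analysis.
From mathcomp Require Import ring lra.
Import numFieldNormedType.Exports.
Import Order.TTheory GRing.Theory Num.Theory.

(** The twist operator is diagonal with unit phases e^(i theta_b), so that the
    expectation value in psi is the average of these phases with weights
    |psi_b|^2, which equal 1 at a and |c_b|^2 + O(J^3) elsewhere.  A nonzero c_b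
    forces a and b to differ only at the two ends of one bond.  By conservation
    of the magnetization one spin unit is then moved by one site, which rotates
    the phase by 2 pi / L, i.e. along a chord of length 2 sin (pi / L). *)

Local Open Scope classical_set_scope.
Local Open Scope complex_scope.
Local Open Scope ring_scope.

(** * Matrix elements of the spin operators in the product basis *)

Section SpinOperators.
Set Implicit Arguments.
Unset Strict Implicit.
Context {R : realType} {L : nat}.
Implicit Types (s t : config L) (phi psi : 'cV[R[i]]_(#|config L|)).

Lemma sum_enum_config (V : nmodType) (F : 'I_#|config L| -> V) :
  \sum_x F x = \sum_s F (enum_rank s).
Proof.
rewrite (reindex (fun s : config L => enum_rank s)) //=.
by exists enum_val => x _; rewrite ?enum_rankK ?enum_valK.
Qed.

Lemma ket_coord s t : @ket R L s (enum_rank t) 0 = (t == s)%:R.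
Proof. by rewrite /ket mxE eqxx andbT (inj_eq enum_rank_inj). Qed.

Lemma inner_sum phi psi :
  inner phi psi = \sum_s conjc (phi (enum_rank s) 0) * psi (enum_rank s) 0.
Proof.
rewrite /inner mxE sum_enum_config; apply: eq_bigr => s _.
by rewrite !mxE.
Qed.

Lemma sum_delta_config (F : config L -> R[i]) s :
  \sum_t (t == s)%:R * F t = F s.
Proof.
rewrite (bigD1 s) //= eqxx mul1r big1 ?addr0 // => t /negPf ->.
by rewrite mul0r.
Qed.

Lemma inner_ket s psi : inner (ket s) psi = psi (enum_rank s) 0.
Proof.
rewrite inner_sum -[RHS](sum_delta_config (fun t => psi (enum_rank t) 0)).
by apply: eq_bigr => t _; rewrite ket_coord conjc_nat.
Qed.

Lemma mul_ket (A : 'M[R[i]]_(#|config L|)) s t :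
  (A *m ket s) (enum_rank t) 0 = A (enum_rank t) (enum_rank s).
Proof.
rewrite mxE sum_enum_config.
rewrite -[RHS](sum_delta_config (fun u => A (enum_rank t) (enum_rank u))).
by apply: eq_bigr => u _; rewrite ket_coord mulrC.
Qed.

Lemma braket_ket (A : 'M[R[i]]_(#|config L|)) s t :
  braket (ket s) A (ket t) = A (enum_rank s) (enum_rank t).
Proof. by rewrite /braket inner_ket mul_ket. Qed.

Lemma prod_sum_config (F : 'I_L -> 'I_2 -> R[i]) :
  \prod_j \sum_b F j b = \sum_(s : config L) \prod_j F j (s j).
Proof. exact: bigA_distr_bigA. Qed.

(** The sum over intermediate configurations of a product over sites distributes into a product of
    single-site sums. *)
Lemma tensor_op_mul (A B : 'I_L -> 'M[R[i]]_2) :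
  tensor_op A *m tensor_op B = tensor_op (fun j => A j *m B j).
Proof.
apply/matrixP => x y; rewrite !mxE sum_enum_config.
under [RHS]eq_bigr => j _ do rewrite mxE.
rewrite prod_sum_config; apply: eq_bigr => u _.
by rewrite !mxE enum_rankK -big_split.
Qed.

Lemma tensor_op_eq0 (A : 'I_L -> 'M[R[i]]_2) s t j :
  A j (s j) (t j) = 0 -> tensor_op A (enum_rank s) (enum_rank t) = 0.
Proof. by move=> Aj0; rewrite mxE !enum_rankK (bigD1 j) //= Aj0 mul0r. Qed.

(** Away from [j] and [k] the tensor factor is the identity, whose off-diagonal entries vanish. The
    case [j = k] is not excluded. *)
Lemma site_op_mul_eq0 (j k i : 'I_L) (A B : 'M[R[i]]_2) s t :
  i != j -> i != k -> s i != t i ->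
  (site_op j A *m site_op k B) (enum_rank s) (enum_rank t) = 0.
Proof.
move=> /negPf ij /negPf ik /negPf st; rewrite tensor_op_mul.
by apply: (@tensor_op_eq0 _ _ _ i); rewrite ij ik mulmx1 mxE st.
Qed.

Lemma spin_dot_eq0 (j k i : 'I_L) s t :
  i != j -> i != k -> s i != t i ->
  @spin_dot R L j k (enum_rank s) (enum_rank t) = 0.
Proof.
move=> ij ik st; rewrite /spin_dot mxE [X in X + _]mxE.
have bond0 A B := @site_op_mul_eq0 j k i A B s t ij ik st.
by rewrite [X in X + _ + _]bond0 [X in _ + X + _]bond0 [X in _ + X]bond0 !addr0.
Qed.

(** * Operators diagonal in the product basis *)

Definition spin s (j : 'I_L) : R := 2^-1 * (-1) ^+ s j.

Definition diag_op (f : config L -> R[i]) : 'M[R[i]]_(#|config L|) :=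
  diag_mx (\row_x f (enum_val x)).

Lemma diag_opE f s t :
  diag_op f (enum_rank s) (enum_rank t) = f s *+ (s == t).
Proof. by rewrite /diag_op !mxE enum_rankK (inj_eq enum_rank_inj). Qed.

Lemma oper_eqP (A B : 'M[R[i]]_(#|config L|)) :
  (forall s t, A (enum_rank s) (enum_rank t) = B (enum_rank s) (enum_rank t)) ->
  A = B.
Proof.
move=> AB; apply/matrixP => x y.
by rewrite -(enum_valK x) -(enum_valK y) AB.
Qed.

Lemma Sz_diag j : Sz j = diag_op (fun s => (spin s j)%:C).
Proof.
apply: oper_eqP => s t; rewrite diag_opE.
have [->|st] := eqVneq s t.
  rewrite mxE !enum_rankK (bigD1 j) //= eqxx big1 => [|k /negPf ->].
    rewrite mulr1 !mxE eqxx !mulr1n /spin rmorphM /= rmorphXn /= rmorphN1.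
    by rewrite fmorphV rmorphMn /= rmorph1.
  by rewrite mxE eqxx.
(* Off the diagonal, one site [k] where [s] and [t] differ kills the product: its factor, identity
   or half of [sigma_z], is diagonal. *)
have /existsP[k sk] : [exists k, s k != t k].
  rewrite -negb_forall; apply: contra st => /forallP E.
  by apply/eqP/ffunP => k; apply/eqP.
apply: (@tensor_op_eq0 _ _ _ k).
by case: eqP => _; rewrite !mxE (negPf sk) ?mulr0n ?mulr0.
Qed.

Lemma diag_op_sum (w : 'I_L -> R[i]) :
  \sum_j w j *: Sz j = diag_op (fun s => \sum_j w j * (spin s j)%:C).
Proof.
apply: oper_eqP => s t; rewrite diag_opE summxE -sumrMnl.
by apply: eq_bigr => j _; rewrite mxE Sz_diag diag_opE mulrnAr.
Qed.

Lemma diag_opX f k : diag_op f ^+ k = diag_op (fun s => f s ^+ k).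
Proof.
elim: k => [|k IH].
  apply: oper_eqP => s t; rewrite expr0 diag_opE expr0.
  by rewrite mxE (inj_eq enum_rank_inj).
rewrite exprS IH; apply: oper_eqP => s t.
rewrite /GRing.mul /= mulmx_diag diag_opE !mxE enum_rankK.
by rewrite (inj_eq enum_rank_inj) exprS.
Qed.

(** This turns an expectation value into an average of the eigenvalues [f s] with weights given by
    the squared moduli of the coordinates. *)
Lemma braket_diag f psi :
  braket psi (diag_op f) psi =
    \sum_s (Normc.normc (psi (enum_rank s) 0) ^+ 2)%:C * f s.
Proof.
rewrite /braket inner_sum; apply: eq_bigr => s _.
rewrite mul_diag_mx !mxE enum_rankK.
case: (psi _ _) => x y; rewrite /= sqr_sqrtr ?addr_ge0 ?sqr_ge0 //.
rewrite mulrCA mulrC; congr (_ * _); apply/eqP.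
by rewrite eq_complex /=; apply/andP; split; apply/eqP; ring.
Qed.

Lemma zero_mag_spin s : zero_mag R s -> \sum_j spin s j = 0.
Proof.
have E : \sum_j @Sz R L j = diag_op (fun s => \sum_j 1 * (spin s j)%:C).
  by rewrite -diag_op_sum; apply: eq_bigr => j _; rewrite scale1r.
move=> /eqP/matrixP/(_ (enum_rank s) 0); rewrite mul_ket mxE E diag_opE eqxx.
rewrite mulr1n; under eq_bigr => j _ do rewrite mul1r.
by rewrite -rmorph_sum /= => /complexI.
Qed.

Lemma zero_sector_coord psi s :
  psi \in zero_sector R L -> ~~ zero_mag R s -> psi (enum_rank s) 0 = 0.
Proof.
move=> /memv_sumP[v vP ->] s0; rewrite summxE big1 // => t t0.
have /vlineP[c ->] := vP t t0.
rewrite mxE ket_coord; case: eqP => [st|_]; last by rewrite mulr0.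
by rewrite st t0 in s0.
Qed.

(** * The exponential series of the twist and its phases *)

Definition twist_angle s : R := 2 * pi / L%:R * \sum_(j < L) j.+1%:R * spin s j.

(** Euler's formula term by term: the powers of [i] are real for even [k] and imaginary for odd
    [k]. *)
Lemma expi_coeff (x : R) k :
  (k`!%:R : R[i])^-1 * ('i%C * x%:C) ^+ k = cos_coeff x k +i* sin_coeff x k.
Proof.
have -> : (k`!%:R : R[i])^-1 = (k`!%:R^-1)%:C by rewrite fmorphV rmorph_nat.
rewrite exprMn -rmorphXn /= mulrCA -rmorphM /=.
have -> : ('i%C : R[i]) ^+ k =
   ((~~ odd k)%:R * (-1) ^+ k./2) +i* ((odd k)%:R * (-1) ^+ k.-1./2).
  rewrite -{1}(odd_double_half k) exprD -mul2n exprM sqr_i.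
  have -> : (-1 : R[i]) ^+ k./2 = ((-1) ^+ k./2)%:C by rewrite rmorphXn rmorphN1.
  case/boolP: (odd k) => ok; rewrite ?expr1 ?expr0.
    (* The exponent of the sign in [sin_coeff] is [k.-1./2], which agrees with [k./2] for odd
       [k]. *)
    have -> : k.-1./2 = k./2 by case: k ok => //= k /negPf; rewrite uphalf_half => ->.
    by apply/eqP; rewrite eq_complex /= mulr1n mulr0n; apply/andP; split; apply/eqP; ring.
  by apply/eqP; rewrite eq_complex /= mulr1n mulr0n; apply/andP; split; apply/eqP; ring.
apply/eqP; rewrite eq_complex /cos_coeff /sin_coeff /=.
by rewrite -exprnP; apply/andP; split; apply/eqP; ring.
Qed.

Lemma twist_diag :
  twist R L = diag_op (fun s => cos (twist_angle s) +i* sin (twist_angle s)).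
Proof.
have genE : ('i%C * (2 * pi / L%:R)%:C) *: (\sum_(j < L) j.+1%:R *: @Sz R L j) =
    diag_op (fun s => 'i%C * (twist_angle s)%:C).
  rewrite diag_op_sum; apply: oper_eqP => s t; rewrite mxE !diag_opE mulrnAr.
  congr (_ *+ _); rewrite -mulrA /twist_angle [in RHS]rmorphM rmorph_sum /=.
  by congr (_ * (_ * _)); apply: eq_bigr => j _; rewrite [RHS]rmorphM;
    congr (_ * _); rewrite /= rmorph_nat.
rewrite /twist genE /expmx; apply: oper_eqP => s t.
rewrite mxE diag_opE.
have termE k : ((k`!%:R : R[i])^-1 *:
      diag_op (fun s => 'i%C * (twist_angle s)%:C) ^+ k)
      (enum_rank s) (enum_rank t) =
    (cos_coeff (twist_angle s) k +i* sin_coeff (twist_angle s) k) *+ (s == t).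
  by rewrite diag_opX mxE diag_opE mulrnAr expi_coeff.
under eq_fun => k do rewrite termE.
under [X in _ +i* limn (series X)]eq_fun => k do rewrite termE.
(* On the diagonal the two series are the ones that define [cos] and [sin]; off the diagonal every
   term is zero. *)
case: eqP => _.
  by rewrite !mulr1n /= !unlock.
rewrite !mulr0n /=.
have -> : series (fun _ : nat => 0 : R) = fun _ => 0.
  by apply/funext => n; rewrite /series /= big1.
by rewrite lim_cst.
Qed.

End SpinOperators.

(** * Chords of the unit circle *)

Section Trigonometry.
Set Implicit Arguments.
Unset Strict Implicit.
Context {R : realType}.
Implicit Types x y : R.

Lemma normc_expi x : Normc.normc (cos x +i* sin x) = 1 :> R.
Proof. by rewrite /= cos2Dsin2 sqrtr1. Qed.

Lemma normc_expi_sub x y :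
  Normc.normc ((cos x +i* sin x) - (cos y +i* sin y)) =
    Num.sqrt (2 - 2 * cos (x - y)).
Proof.
rewrite /= cosB; congr Num.sqrt.
have := cos2Dsin2 x; have := cos2Dsin2 y; lra.
Qed.

(** The half-angle formula: the chord subtending the angle [2 y] has length [2 sin y]. *)
Lemma sqrt_chord y : 0 <= sin y -> Num.sqrt (2 - 2 * cos (y *+ 2)) = 2 * sin y.
Proof.
move=> sy; rewrite cos_mulr2n.
have -> : 2 - 2 * (cos y ^+ 2 *+ 2 - 1) = (2 * sin y) ^+ 2.
  by rewrite cos2sin2; ring.
by rewrite sqrtr_sqr ger0_norm ?mulr_ge0.
Qed.

(* Across the boundary bond the shift is L - 1 instead of -1, which is the same
   modulo the period L. *)
Lemma cos_bond_shift (L : nat) (j : 'I_L) : (2 <= L)%N ->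
  cos (2 * pi / L%:R * (j.+1%:R - (ordS j).+1%:R)) = cos (2 * pi / L%:R) :> R.
Proof.
move=> L2; have L0 : L%:R != 0 :> R by rewrite pnatr_eq0; case: L L2 j.
have [jL|jL] := ltnP j.+1 L.
  rewrite /= modn_small // -(cosN (2 * pi / _)); congr cos.
  by rewrite -[j.+2]addn1 natrD; ring.
have eL : j.+1 = L by apply/eqP; rewrite eqn_leq ltn_ord.
rewrite /= eL modnn.
have -> : 2 * pi / L%:R * (L%:R - 1) = - (2 * pi / L%:R) + pi *+ 2 :> R.
  by field.
by rewrite cosD2pi cosN.
Qed.

End Trigonometry.

(** * Twist phases of configurations coupled by one bond *)

Section TwistOfBondNeighbours.
Set Implicit Arguments.
Unset Strict Implicit.
Context {R : realType} {L : nat}.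
Implicit Types s t : config L.

Lemma sum_supported2 (F : 'I_L -> R) j k : j != k ->
  (forall i, i != j -> i != k -> F i = 0) -> \sum_i F i = F j + F k.
Proof.
move=> jk F0; rewrite (bigD1 j) //= (bigD1 k) 1?eq_sym //= big1 ?addr0 //.
by move=> i /andP[]; exact: F0.
Qed.

Lemma ordS_neq (j : 'I_L) : (2 <= L)%N -> j != ordS j.
Proof.
move=> L2; rewrite -val_eqE /=; have [jL|jL] := ltnP j.+1 L.
  by rewrite modn_small // neq_ltn ltnSn.
have eL : j.+1 = L by apply/eqP; rewrite eqn_leq ltn_ord.
by rewrite eL modnn; rewrite -eL ltnS in L2; rewrite -lt0n.
Qed.

(** Both magnetizations vanish, so the spin changes at [j] and [k] are opposite and only the
    difference of the two site labels survives. *)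
Lemma twist_angle_sub s t (j k : 'I_L) : j != k ->
  (forall i, i != j -> i != k -> s i = t i) ->
  zero_mag R s -> zero_mag R t ->
  @twist_angle R L s - twist_angle t =
    2 * pi / L%:R * (j.+1%:R - k.+1%:R) * (spin s j - spin t j).
Proof.
move=> jk st /zero_mag_spin s0 /zero_mag_spin t0.
have d0 i : i != j -> i != k -> spin s i - spin t i = 0 :> R.
  by move=> ij ik; rewrite /spin st // subrr.
have: \sum_i (spin s i - spin t i) = 0 :> R by rewrite sumrB s0 t0 subrr.
rewrite (sum_supported2 jk d0) => dk.
rewrite /twist_angle -mulrBr -sumrB.
under eq_bigr => i _ do rewrite -mulrBr.
rewrite (sum_supported2 jk) => [|i ij ik]; last by rewrite d0 ?mulr0.
have -> : spin s k - spin t k = - (spin s j - spin t j) :> R by lra.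
by ring.
Qed.

Lemma spin_sub_cases s t j :
  [\/ spin s j - spin t j = 0 :> R, spin s j - spin t j = 1 :> R |
      spin s j - spin t j = -1 :> R].
Proof.
rewrite /spin; case: (s j) => [[|[|//]] ?]; case: (t j) => [[|[|//]] ?] /=.
- by constructor 1; rewrite subrr.
- by constructor 2; rewrite expr0 expr1; lra.
- by constructor 3; rewrite expr0 expr1; lra.
- by constructor 1; rewrite subrr.
Qed.

(** By contraposition: if every bond misses some site where [s] and [t] differ, each term of the
    interaction vanishes between them. *)
Lemma interaction_bond (J : R) s t :
  interaction J (enum_rank s) (enum_rank t) != 0 ->
  exists j : 'I_L, forall i, i != j -> i != ordS j -> s i = t i.
Proof.
move=> H; apply: contrapT => nex; case/negP: H; apply/eqP.
rewrite /interaction mxE summxE big1 ?mulr0 // => j _.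
have /existsNP[i /not_implyP[ij /not_implyP[ik /eqP sti]]] :
  ~ (forall i, i != j -> i != ordS j -> s i = t i).
  by move=> E; apply: nex; exists j.
exact: spin_dot_eq0 ij ik sti.
Qed.

Lemma twist_phase_sub (J : R) s t : (2 <= L)%N ->
  zero_mag R s -> zero_mag R t ->
  interaction J (enum_rank s) (enum_rank t) != 0 ->
  Normc.normc ((cos (@twist_angle R L s) +i* sin (twist_angle s)) -
               (cos (twist_angle t) +i* sin (twist_angle t)))
    <= 2 * sin (pi / L%:R).
Proof.
(* The angle difference is [2 pi / L] times the label shift times a spin change 0, 1 or -1. The
   first case gives distance zero; the other two give the same chord because [cos] is even. *)
move=> L2 s0 t0 /interaction_bond[j stj].
have piL : 0 <= sin (pi / L%:R) :> R.
  apply: sin_ge0_pi; rewrite divr_ge0 ?pi_ge0 //= ler_pdivrMr ?ltr0n ?(ltnW L2) //.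
  by rewrite ler_peMr ?pi_ge0 // ler1n ltnW.
rewrite normc_expi_sub (twist_angle_sub (ordS_neq j L2) stj s0 t0).
have [->|->|->] := spin_sub_cases s t j.
- by rewrite mulr0 cos0 mulr1 subrr sqrtr0 mulr_ge0.
- rewrite mulr1 cos_bond_shift // -sqrt_chord //.
  by rewrite le_eqVlt; apply/orP; left; apply/eqP; congr (Num.sqrt (2 - 2 * cos _)); ring.
- rewrite mulrN1 cosN cos_bond_shift // -sqrt_chord //.
  by rewrite le_eqVlt; apply/orP; left; apply/eqP; congr (Num.sqrt (2 - 2 * cos _)); ring.
Qed.

End TwistOfBondNeighbours.

(** * Averages of phases under perturbed weights *)

Section Perturbation.
Set Implicit Arguments.
Unset Strict Implicit.
Context {R : realType}.
Local Notation normc := (@Normc.normc R).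

Lemma normc_ge0 (x : R[i]) : 0 <= normc x.
Proof. by case: x => x y; exact: sqrtr_ge0. Qed.

Lemma normc_real (x : R) : normc x%:C = `|x|.
Proof. by rewrite /= expr0n addr0 sqrtr_sqr. Qed.

Lemma le_normc_sum (T : finType) (P : pred T) (F : T -> R[i]) :
  normc (\sum_(b | P b) F b) <= \sum_(b | P b) normc (F b).
Proof.
apply: (big_ind2 (fun x y => normc x <= y)) => [|x y z w xy zw|//].
  by rewrite Normc.normc0.
by apply: le_trans (le_normcD _ _) _; exact: lerD.
Qed.

(** Factor the difference of squares: the moduli differ by at most [e], and their sum is at most
    [2 * normc y + e]. *)
Lemma sqr_normc_sub (x y : R[i]) (e : R) : normc (x - y) <= e ->
  `|normc x ^+ 2 - normc y ^+ 2| <= e * (2 * normc y + e).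
Proof.
move=> xye.
have xy : normc x <= e + normc y.
  by rewrite -[in normc x](subrK y x); apply: le_trans (le_normcD _ _) _; rewrite lerD2r.
have yx : normc y <= e + normc x.
  rewrite -[in normc y](subrK x y); apply: le_trans (le_normcD _ _) _.
  by rewrite lerD2r -opprB normcN.
have := normc_ge0 x; have := normc_ge0 y; have := normc_ge0 (x - y).
by move=> d0 y0 x0; rewrite ler_norml; apply/andP; split; nra.
Qed.

(** The estimate freed from spins: [u] are the phases, [v] the exact amplitudes, [c] their
    first-order approximations up to [e]. The weights 1 at [a] and [normc (c b) ^+ 2] elsewhere add
    up to [1 + N], so dividing by it gives a true average, which the phases move away from [u a] by
    at most [D] times the weight off [a]. *)
Lemma perturbed_average (T : finType) (P : pred T) (u v c : T -> R[i]) (a : T)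
    (D e : R) :
  let N := \sum_(b | P b && (b != a)) normc (c b) ^+ 2 in
  P a -> normc (v a) = 1 -> (forall b, ~~ P b -> v b = 0) ->
  (forall b, P b && (b != a) -> normc (v b - c b) <= e) ->
  (forall b, normc (u b) = 1) ->
  (forall b, P b && (b != a) -> c b != 0 -> normc (u b - u a) <= D) ->
  normc ((\sum_b (normc (v b) ^+ 2)%:C * u b) / (1 + N)%:C - u a) <=
    D * (N / (1 + N)) + \sum_(b | P b && (b != a)) e * (2 * normc (c b) + e).
Proof.
move=> N Pa va1 v0 vc u1 uD.
have N0 : 0 <= N by apply: sumr_ge0 => b _; exact: sqr_ge0.
have N1 : 0 < 1 + N by rewrite ltr_wpDr.
have NC : (1 + N)%:C != 0 :> R[i].
  by rewrite -(rmorph0 (real_complex R)) (inj_eq (@complexI R)) gt_eqF.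
(* [A] is the error of replacing exact weights by first-order ones; [B] is the displacement of the
   phases under the first-order weights. *)
pose A := \sum_(b | P b && (b != a)) (normc (v b) ^+ 2 - normc (c b) ^+ 2)%:C * u b.
pose B := \sum_(b | P b && (b != a)) (normc (c b) ^+ 2)%:C * (u b - u a).
have -> : (\sum_b (normc (v b) ^+ 2)%:C * u b) / (1 + N)%:C - u a =
    (A + B) / (1 + N)%:C.
  have -> : \sum_b (normc (v b) ^+ 2)%:C * u b = A + B + u a * (1 + N)%:C.
    rewrite (bigID P) /= [X in _ + X]big1 => [|b /v0 ->]; last first.
      by rewrite Normc.normc0 expr0n mul0r.
    rewrite addr0 (bigD1 a) //= va1 expr1n mul1r.
    rewrite rmorphD rmorph1 mulrDr mulr1 addrC addrA [RHS]addrAC; congr (_ + _).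
    rewrite /A /B /N rmorph_sum mulr_sumr -!big_split /=.
    by apply: eq_bigr => b _; rewrite rmorphB /=; ring.
  by rewrite mulrDl mulfK // addrK.
rewrite Normc.normcM Normc.normcV normc_real (gtr0_norm N1) mulrA.
rewrite ler_pdivrMr // mulrDl divfK ?gt_eqF // [leRHS]addrC.
apply: le_trans (le_normcD _ _) _; apply: lerD.
  apply: (@le_trans _ _ (\sum_(b | P b && (b != a)) e * (2 * normc (c b) + e))).
    apply: le_trans (le_normc_sum _ _) _; apply: ler_sum => b Pb.
    rewrite Normc.normcM u1 mulr1 normc_real.
    exact: sqr_normc_sub (vc b Pb).
  (* Clearing the denominator left a factor [1 + N], at least 1, on the error sum. Its terms are
     nonnegative since they bound absolute values. *)
  rewrite ler_peMr ?lerDl //; apply: sumr_ge0 => b Pb.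
  exact: le_trans (normr_ge0 _) (sqr_normc_sub (vc b Pb)).
apply: le_trans (le_normc_sum _ _) _; rewrite /N mulr_sumr.
apply: ler_sum => b Pb; rewrite Normc.normcM normc_real ger0_norm ?sqr_ge0 //.
(* The distance bound [D] is only available where [c b] is nonzero; elsewhere the weight is zero. *)
rewrite mulrC; have [->|cb] := eqVneq (c b) 0.
  by rewrite Normc.normc0 expr0n !mulr0.
by rewrite ler_wpM2r ?sqr_ge0 ?uD.
Qed.

Lemma normc_coord_le_hnorm (L : nat) (v : 'cV[R[i]]_(#|config L|)) s :
  normc (v (enum_rank s) 0) <= hnorm v.
Proof.
have -> : hnorm v = Num.sqrt (\sum_t normc (v (enum_rank t) 0) ^+ 2).
  rewrite /hnorm inner_sum raddf_sum /=; congr Num.sqrt; apply: eq_bigr => t _.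
  case: (v _ _) => x y /=; rewrite sqr_sqrtr ?addr_ge0 ?sqr_ge0 //; ring.
rewrite -[leLHS]ger0_norm ?normc_ge0 // -sqrtr_sqr ler_wsqrtr //.
by rewrite (bigD1 s) //= lerDl sumr_ge0 // => t _; exact: sqr_ge0.
Qed.

(** Isolates the dependence on [J], so that the constants of the final remainder can be taken at
    [J = 1]. *)
Lemma first_order_coefE (L : nat) (E0 : config L -> R) s J t :
  first_order_coef E0 s J t = J%:C * first_order_coef E0 s 1 t.
Proof.
rewrite /first_order_coef !braket_ket /interaction mulrA; congr (_ / _).
by rewrite mxE [in RHS]mxE mul1r.
Qed.

Lemma first_order_ket_coord (L : nat) (P : pred (config L)) (c : config L -> R[i])
    (a b : config L) : P b -> b != a ->
  (ket a + \sum_(t | P t && (t != a)) c t *: ket t) (enum_rank b) 0 = c b.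
Proof.
move=> Pb ba; rewrite mxE ket_coord (negPf ba) add0r summxE (bigD1 b) ?Pb //=.
rewrite mxE ket_coord eqxx mulr1 big1 ?addr0 // => t /andP[_ tb].
by rewrite mxE ket_coord eq_sym (negPf tb) mulr0.
Qed.

End Perturbation.

(** * The twist estimate and its third-order remainder *)

Theorem mainTheorem2 (R : realType) (L : nat) (L_ge2 : (2 <= L)%N)
  (L_even : ~~ odd L) (h : 'I_L -> R)
  (E0 : config L -> R)
  (E0P : forall b : config L, zero_mag R b ->
     hamiltonian0 h *m ket b = (E0 b)%:C *: ket b)
  (a : config L) (a_zero : zero_mag R a)
  (a_nondeg : forall b : config L, zero_mag R b -> b != a -> E0 b != E0 a)
  (psi : R -> 'cV[R[i]]_(#|config L|))
  (psi_sector : \forall J \near (0 : R), psi J \in zero_sector R L)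
  (psi_eigen : \forall J \near (0 : R),
     exists E : R[i], hamiltonian h J *m psi J = E *: psi J)
  (psi_coef : \forall J \near (0 : R), inner (ket a) (psi J) = 1)
  (psi_first_order :
     (fun J : R => hnorm (psi J - (ket a
        + \sum_(b | zero_mag R b && (b != a))
            first_order_coef E0 a J b *: ket b)))
     =O_ (0 : R) (fun J : R => J ^+ 2)) :
  exists2 r : R -> R, r =O_ (0 : R) (fun J : R => J ^+ 3) &
    \forall J \near (0 : R),
      Normc.normc
        (braket (psi J) (twist R L) (psi J) / (1 + norm_order2 E0 a J)%:C
         - braket (ket a) (twist R L) (ket a))
      <= 2 * sin (pi / L%:R)
           * (norm_order2 E0 a J / (1 + norm_order2 E0 a J)) + r J.
Proof.
have [K K0 psiK] := (eqO_exP _ _ _).1 psi_first_order.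
pose w b := Normc.normc (first_order_coef E0 a 1 b).
have w0 b : 0 <= w b by exact: normc_ge0.
(* With [e = K * J ^+ 2] and first-order amplitude [w b * |J|], the error [e * (2 * w b * |J| + e)]
   has a cubic and a quartic part; for [|J| < 1] the quartic is absorbed into the cubic, which gives
   this constant. *)
pose M := \sum_(b | zero_mag R b && (b != a)) K * (2 * w b + K).
exists (fun J => M * `|J| ^+ 3).
  (* Adding 1 makes the constant strictly positive, knowing only that [M] is nonnegative. *)
  apply/eqO_exP; exists (M + 1).
    rewrite ltr_wpDl // sumr_ge0 // => b _.
    by rewrite mulr_ge0 ?addr_ge0 ?mulr_ge0 // ltW.
  apply: nearW => J /=; rewrite !normrX normrM normrX normr_id ler_wpM2r ?exprn_ge0 //.
  rewrite ger0_norm ?lerDl // sumr_ge0 // => b _.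
  by rewrite mulr_ge0 ?addr_ge0 ?mulr_ge0 // ltW.
have J1 : \forall J \near (0 : R), `|J| < 1.
  by have := @nbhs0_lt _ R 1 ltr01.
near=> J.
have sector : psi J \in zero_sector R L by near: J.
have coef : inner (ket a) (psi J) = 1 by near: J.
have err : `|hnorm (psi J - (ket a + \sum_(b | zero_mag R b && (b != a))
    first_order_coef E0 a J b *: ket b))| <= K * `|J ^+ 2| by near: J.
have J_lt1 : `|J| < 1 by near: J.
rewrite twist_diag braket_diag braket_ket diag_opE eqxx mulr1n.
apply: le_trans
  (@perturbed_average R _ (zero_mag R) _ (fun b => psi J (enum_rank b) 0)
    (first_order_coef E0 a J) a (2 * sin (pi / L%:R)) (K * J ^+ 2)
    a_zero _ _ _ _ _) _.
- by rewrite -inner_ket coef Normc.normc1.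
- by move=> b; exact: zero_sector_coord.
- move=> b /andP[b0 ba].
  have := normc_coord_le_hnorm (psi J - (ket a + \sum_(b | zero_mag R b && (b != a))
    first_order_coef E0 a J b *: ket b)) b.
  rewrite [X in Normc.normc X]mxE [X in _ + X]mxE first_order_ket_coord // => le1.
  apply: le_trans le1 (le_trans (ler_norm _) (le_trans err _)).
  by rewrite ger0_norm ?sqr_ge0.
- by move=> b; exact: normc_expi.
- move=> b /andP[b0 ba] cb; apply: (@twist_phase_sub _ _ J) => //.
  apply: contra cb => /eqP V0.
  by rewrite /first_order_coef braket_ket V0 mul0r.
rewrite lerD2l /M mulr_suml; apply: ler_sum => b _.
rewrite first_order_coefE Normc.normcM normc_real -/(w b).
rewrite -[J ^+ 2]real_normK ?num_real //.
have := w0 b; have := normr_ge0 J; move: (w b) `|J| J_lt1 K0 => x y y1 K0 y0 x0.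
rewrite -subr_ge0.
(* Here [x] is [w b] and [y] is [|J|]; the cubic parts cancel and what is left is nonnegative as
   [y < 1]. *)
have -> : K * (2 * x + K) * y ^+ 3 - K * y ^+ 2 * (2 * (y * x) + K * y ^+ 2) =
  K ^+ 2 * y ^+ 3 * (1 - y) by ring.
by rewrite !mulr_ge0 ?exprn_ge0 ?subr_ge0 // ltW.
Unshelve. all: by end_near.
Qed.
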